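(* Let $\boldsymbol\tau=(n,k_2,k_3,\ell_2,\ell_3)$ be a combinatorial type with $n\ge2$. The numbers $H(\boldsymbol\tau)$ of subgroups of $\mathrm{PSL}_2(\mathbb Z)$, $L(\boldsymbol\tau)$ of labeled rooted $\mathrm{PSL}_2(\mathbb Z)$-reduced graphs, and $s(\boldsymbol\tau)$ of labeled $\mathrm{PSL}_2(\mathbb Z)$-cyclically reduced graphs, of combinatorial type $\boldsymbol\tau$, are related as follows: $$L(\boldsymbol\tau)=n\,s(n,k_2,k_3,\ell_2,\ell_3)+(\ell_2+1)\,s(n,k_2,k_3,\ell_2+1,\ell_3)+(\ell_3+1)\,s(n,k_2,k_3,\ell_2,\ell_3+1),$$ $$H(\boldsymbol\tau)=\frac1{n!}\,L(\boldsymbol\tau).$$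
   Context: $\mathrm{PSL}_2(\mathbb Z)=\langle a,b\mid a^2=b^3=1\rangle$. Each element has a unique geodesic representative (words over $\{a,b,b^{-1}\}$ of length at most 1, or alternating $a$ and letters in $\{b,b^{-1}\}$). The Schreier graph of a subgroup $H$ has vertices the cosets $Hg$, undirected $a$-edges between $Hg$ and $Hga$ and directed $b$-edges from $Hg$ to $Hgb$; the Stallings graph $(\Gamma(H),v_0)$ is its subgraph spanned by the loops at $v_0=H$ labeled by geodesic representatives of elements of $H$, rooted at $v_0$. Consider finite connected graphs with undirected $a$-edges and directed $b$-edges such that: every vertex lies on at most one $a$-edge, which is either an $a$-loop or an isolated $a$-edge (joining two distinct vertices); the $b$-edges form a partial injective map on vertices, and each $b$-edge is a $b$-loop, or an isolated $b$-edge (joining two distinct vertices lying on no other $b$-edge), or one of the edges of a $b$-triangle (a directed 3-cycle on three distinct vertices). Such a graph is $\mathrm{PSL}_2(\mathbb Z)$-cyclically reduced if every vertex is adjacent to an $a$-edge and to a $b$-edge; a rooted such graph $(\Gamma,v)$ is $\mathrm{PSL}_2(\mathbb Z)$-reduced if every vertex except possibly the root $v$ is adjacent to an $a$-edge and to a $b$-edge. The map $H\mapsto(\Gamma(H),v_0)$ is a bijection from finitely generated subgroups of $\mathrm{PSL}_2(\mathbb Z)$ to (isomorphism classes of) $\mathrm{PSL}_2(\mathbb Z)$-reduced rooted graphs. A graph with $n$ vertices is labeled if its vertex set is $\{1,\dots,n\}$. The combinatorial type of a graph is $(n,k_2,k_3,\ell_2,\ell_3)$, where $n$ is the number of vertices,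 $k_2,k_3$ the numbers of isolated $a$- and $b$-edges, and $\ell_2,\ell_3$ the numbers of $a$- and $b$-loops; the combinatorial type of a finitely generated subgroup is that of its Stallings graph. *)

(* Defs.v *)
From HB Require Import structures.
From mathcomp Require Import all_boot all_order all_algebra finmap.
From mathcomp Require Import boolp classical_sets functions cardinality.

Set Implicit Arguments.
Unset Strict Implicit.
Unset Printing Implicit Defensive.

Local Open Scope classical_set_scope.
Local Open Scope card_scope.

(* Words over {a, b, b^-1}; [lB] stands for b^-1, and a is its own inverse. *)
Inductive letter := la | lb | lB.

Definition is_a (x : letter) : bool := if x is la then true else false.

Definition letter_code (x : letter) : option bool :=
  match x with la => None | lb => Some true | lB => Some false end.

Definition letter_decode (c : option bool) : letter :=
  match c with None => la | Some true => lb | Some false => lB end.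

Lemma letter_codeK : cancel letter_code letter_decode.
Proof. by case. Qed.

HB.instance Definition _ := Finite.copy letter (can_type letter_codeK).

Definition word := seq letter.

Definition linv (x : letter) : letter :=
  match x with la => la | lb => lB | lB => lb end.

Definition winv (w : word) : word := rev (map linv w).

(* The congruence presenting < a, b | a^2 = b^3 = 1 >. *)
Inductive weq : word -> word -> Prop :=
| weq_refl w : weq w w
| weq_sym v w : weq v w -> weq w v
| weq_trans u v w : weq u v -> weq v w -> weq u w
| weq_cat u u' v v' : weq u u' -> weq v v' -> weq (u ++ v) (u' ++ v')
| weq_aa : weq [:: la; la] [::]
| weq_bbb : weq [:: lb; lb; lb] [::]
| weq_bB : weq [:: lb; lB] [::]
| weq_Bb : weq [:: lB; lb] [::].

Lemma weq_winv u v : weq u v -> weq (winv u) (winv v).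
Proof.
have E x y : winv (x ++ y) = winv y ++ winv x by rewrite /winv map_cat rev_cat.
elim=> {u v} [w|v w _ IH|u v w _ IHu _ IHv|u u' v v' _ IHu _ IHv||||].
- exact: weq_refl.
- exact: weq_sym.
- exact: weq_trans IHu IHv.
- by rewrite !E; apply: weq_cat.
- exact: weq_aa.
- apply: weq_sym; apply: (@weq_trans _ [:: lB; lb]); first exact/weq_sym/weq_Bb.
  have ins (x y : word) : weq (x ++ y) (x ++ [:: lB; lb] ++ y).
    apply: weq_cat (weq_refl _) _; rewrite -[X in weq X]cat0s.
    by apply: weq_cat (weq_refl _); apply/weq_sym/weq_Bb.
  apply: weq_trans (ins [:: lB] [:: lb]) _.
  apply: weq_trans (ins [:: lB; lB] [:: lb; lb]) _.
  exact: (weq_cat (weq_refl [:: lB; lB; lB]) weq_bbb).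
- exact: weq_bB.
- exact: weq_Bb.
Qed.

Lemma weq_mulV w : weq (winv w ++ w) [::].
Proof.
elim: w => [|x w IH]; first exact: weq_refl.
rewrite /winv /= rev_cons -/(winv w) cat_rcons.
apply: weq_trans IH; apply: weq_cat (weq_refl _) _.
rewrite -[X in weq _ X]cat0s -[linv x :: _]/([:: linv x; x] ++ w).
apply: weq_cat (weq_refl _).
by case: x; [exact: weq_aa | exact: weq_Bb | exact: weq_bB].
Qed.

Definition weqb : rel word := fun u v => `[< weq u v >].

Lemma weqb_refl : reflexive weqb.
Proof. by move=> w; apply/asboolP/weq_refl. Qed.

Lemma weqb_sym : symmetric weqb.
Proof. by move=> u v; apply/asboolP/asboolP; apply: weq_sym. Qed.

Lemma weqb_trans : transitive weqb.
Proof.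
by move=> v u w /asboolP uv /asboolP vw; apply/asboolP/(weq_trans uv vw).
Qed.

Canonical weqb_equiv := EquivRel weqb weqb_refl weqb_sym weqb_trans.

Local Open Scope quotient_scope.

Definition PSL2Z := {eq_quot weqb}.
HB.instance Definition _ := EqQuotient.on PSL2Z.
HB.instance Definition _ := Choice.on PSL2Z.

(* The element of the group represented by a word. *)
Definition cls (w : word) : PSL2Z := \pi_(PSL2Z) w.

Lemma clsP u v : cls u = cls v <-> weq u v.
Proof.
split=> [/eqP|uv]; first by rewrite eqmodE => /asboolP.
by apply/eqP; rewrite eqmodE; apply/asboolP.
Qed.

Lemma cls_repr (x : PSL2Z) : cls (repr x) = x.
Proof. exact: reprK. Qed.

Lemma repr_cls w : weq (repr (cls w)) w.
Proof. by apply/clsP; rewrite cls_repr. Qed.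

Definition psl_one : PSL2Z := cls [::].
Definition psl_mul (x y : PSL2Z) : PSL2Z := cls (repr x ++ repr y).
Definition psl_inv (x : PSL2Z) : PSL2Z := cls (winv (repr x)).

Lemma psl_mulE u v : psl_mul (cls u) (cls v) = cls (u ++ v).
Proof. by apply/clsP/weq_cat; apply: repr_cls. Qed.

Lemma psl_invE u : psl_inv (cls u) = cls (winv u).
Proof. by apply/clsP/weq_winv/repr_cls. Qed.

Lemma psl_mulA : associative psl_mul.
Proof.
move=> x y z; rewrite -(cls_repr x) -(cls_repr y) -(cls_repr z).
by rewrite !psl_mulE catA.
Qed.

Lemma psl_mul1 : left_id psl_one psl_mul.
Proof. by move=> x; rewrite -(cls_repr x) psl_mulE. Qed.

Lemma psl_mulr1 : right_id psl_one psl_mul.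
Proof. by move=> x; rewrite -(cls_repr x) psl_mulE cats0. Qed.

Lemma psl_mulV : left_inverse psl_one psl_inv psl_mul.
Proof.
by move=> x; rewrite -(cls_repr x) psl_invE psl_mulE; apply/clsP/weq_mulV.
Qed.

Lemma psl_mulrV : right_inverse psl_one psl_inv psl_mul.
Proof.
move=> x; rewrite -[psl_mul _ _]psl_mul1 -{1}(psl_mulV (psl_inv x)) -psl_mulA.
by rewrite [psl_mul (psl_inv x) _]psl_mulA psl_mulV psl_mul1 psl_mulV.
Qed.

HB.instance Definition _ :=
  isGroup.Build PSL2Z psl_mulA psl_mul1 psl_mulr1 psl_mulV psl_mulrV.

Definition gen_a : PSL2Z := cls [:: la].
Definition gen_b : PSL2Z := cls [:: lb].

(* Words of length at most 1, or alternating a and letters in {b, b^-1}. *)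
Definition geodesic (w : word) : bool :=
  sorted (fun x y => is_a x != is_a y) w.

Definition is_subgroup (H : set PSL2Z) : Prop := group_closed [in H].

Definition finitely_generated (H : set PSL2Z) : Prop :=
  exists2 S : set PSL2Z, finite_set S & H = smallest is_subgroup S.

(* Undirected a-edges are encoded as a symmetric set of ordered pairs. *)
Record graph (V : Type) := Graph {
  verts : set V;
  aedge : set (V * V);
  bedge : set (V * V)
}.

HB.instance Definition _ (V : Type) := gen_eqMixin (graph V).
HB.instance Definition _ (V : Type) := gen_choiceMixin (graph V).

(* The letter b^-1 reads a b-edge backwards. *)
Definition step V (G : graph V) (l : letter) : set (V * V) :=
  match l with
  | la => aedge G
  | lb => bedge G
  | lB => [set e | bedge G (e.2, e.1)]
  end.

Fixpoint walk V (G : graph V) (x : V) (w : word) (y : V) : Prop :=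
  if w is l :: w' then exists2 z, step G l (x, z) & walk G z w' y else x = y.

Definition right_coset (H : set PSL2Z) (g : PSL2Z) : set PSL2Z :=
  [set (h * g)%g | h in H].

Definition schreier (H : set PSL2Z) : graph (set PSL2Z) :=
  Graph (range (right_coset H))
        (range (fun g => (right_coset H g, right_coset H (g * gen_a)%g)))
        (range (fun g => (right_coset H g, right_coset H (g * gen_b)%g))).

(* Some loop at the vertex H of the Schreier graph, labeled by the geodesic
   representative u w v of an element of H, visits x after u and y after u w. *)
Definition on_loop (H : set PSL2Z) (w : word) (x y : set PSL2Z) : Prop :=
  exists u v : word,
    [/\ geodesic (u ++ w ++ v), H (cls (u ++ w ++ v)),
        walk (schreier H) (right_coset H 1%g) u x,
        walk (schreier H) x w y &
        walk (schreier H) y v (right_coset H 1%g)].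

Definition stallings (H : set PSL2Z) : graph (set PSL2Z) :=
  Graph [set x | on_loop H [::] x x]
        [set e | on_loop H [:: la] e.1 e.2 \/ on_loop H [:: la] e.2 e.1]
        [set e | on_loop H [:: lb] e.1 e.2 \/ on_loop H [:: lB] e.2 e.1].

Definition connected_graph V (G : graph V) : Prop :=
  forall x y, verts G x -> verts G y -> exists w, walk G x w y.

Definition isolated_bedge V (G : graph V) (e : V * V) : Prop :=
  [/\ bedge G e, e.1 <> e.2 &
      forall f, bedge G f ->
        [\/ f.1 = e.1, f.1 = e.2, f.2 = e.1 | f.2 = e.2] -> f = e].

Definition triangle_bedge V (G : graph V) (e : V * V) : Prop :=
  exists z, [/\ e.1 <> e.2, e.2 <> z & z <> e.1] /\
            [/\ bedge G e, bedge G (e.2, z) & bedge G (z, e.1)].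

(* Each a-edge of such a graph is automatically an a-loop or isolated. *)
Record psl_graph V (G : graph V) : Prop := {
  psl_finite : finite_set (verts G);
  psl_connected : connected_graph G;
  psl_ends : forall l x y, step G l (x, y) -> verts G x /\ verts G y;
  psl_a_sym : forall x y, aedge G (x, y) -> aedge G (y, x);
  psl_a_unique : forall x y z, aedge G (x, y) -> aedge G (x, z) -> y = z;
  psl_b_fun : forall x y z, bedge G (x, y) -> bedge G (x, z) -> y = z;
  psl_b_inj : forall x y z, bedge G (x, z) -> bedge G (y, z) -> x = y;
  psl_b_shape : forall e, bedge G e ->
    [\/ e.1 = e.2, isolated_bedge G e | triangle_bedge G e]
}.

Definition on_a_and_b V (G : graph V) (x : V) : Prop :=
  (exists y, aedge G (x, y)) /\ (exists y, bedge G (x, y) \/ bedge G (y, x)).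

Definition cyclically_reduced V (G : graph V) : Prop :=
  psl_graph G /\ forall x, verts G x -> on_a_and_b G x.

Definition rooted_reduced V (G : graph V) (v : V) : Prop :=
  [/\ psl_graph G, verts G v &
      forall x, verts G x -> x <> v -> on_a_and_b G x].

(* Isolated a-edges are undirected, hence counted as unordered pairs. *)
Definition has_type V (G : graph V) (n k2 k3 l2 l3 : nat) : Prop :=
  [/\ verts G #= `I_n,
      [set E : set V | exists x y,
         [/\ aedge G (x, y), x <> y & E = [set x; y]]] #= `I_k2,
      [set e | isolated_bedge G e] #= `I_k3,
      [set x | aedge G (x, x)] #= `I_l2 &
      [set x | bedge G (x, x)] #= `I_l3].

(* Labeled graphs with n vertices have vertex set 'I_n = {0, ..., n-1}. *)
Definition cyclically_reduced_graphs (n k2 k3 l2 l3 : nat) : set (graph 'I_n) :=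
  [set G | [/\ verts G = setT, cyclically_reduced G &
               has_type G n k2 k3 l2 l3]].

Definition rooted_reduced_graphs (n k2 k3 l2 l3 : nat) :
    set (graph 'I_n * 'I_n) :=
  [set Gv | [/\ verts Gv.1 = setT, rooted_reduced Gv.1 Gv.2 &
                has_type Gv.1 n k2 k3 l2 l3]].

Definition subgroups_of_type (n k2 k3 l2 l3 : nat) : set (set PSL2Z) :=
  [set H | [/\ is_subgroup H, finitely_generated H &
               has_type (stallings H) n k2 k3 l2 l3]].

Arguments cyclically_reduced_graphs : clear implicits.
Arguments rooted_reduced_graphs : clear implicits.

(* [fset_set A] is empty when A is infinite, so these cardinals are meaningful
   only for finite A; this is automatic for the first two. *)
Definition s_count (n k2 k3 l2 l3 : nat) : nat :=
  #|` fset_set (cyclically_reduced_graphs n k2 k3 l2 l3)|%fset.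

Definition L_count (n k2 k3 l2 l3 : nat) : nat :=
  #|` fset_set (rooted_reduced_graphs n k2 k3 l2 l3)|%fset.

Definition H_count (n k2 k3 l2 l3 : nat) : nat :=
  #|` fset_set (subgroups_of_type n k2 k3 l2 l3)|%fset.

(* Main.v *)
(* Words are put in geodesic normal form, and walks in a PSL2(Z)-reduced graph
   survive the reduction. A rooted reduced graph (G, v) determines the subgroup
   H of the labels of its closed walks at v, and sends a vertex x to the coset
   of the labels of walks from v to x. This map is an isomorphism from G onto
   the Stallings graph of H: every edge of G lies on a geodesic loop, because
   following a alternately with one of b, b^-1 permutes a finite set of states,
   so the states entered from v are closed under going backwards. Conversely
   the Stallings graph of H is reduced with loop subgroup H, as its edges are
   the Schreier edges whose two ends can be reached by a geodesic of the other
   kind. Hence labeled rooted graphs are the same as pairs (subgroup,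
   bijection from {1..n} to the Stallings vertices), which gives the factor n!.
   In the first identity, a rooted reduced graph is either cyclically reduced,
   or becomes so by adding one a-loop or one b-loop at its root. *)
Require Import Defs.
From mathcomp Require Import all_boot all_order all_algebra finmap perm.
From mathcomp Require Import boolp classical_sets functions cardinality.

Set Implicit Arguments.
Unset Strict Implicit.
Unset Printing Implicit Defensive.

Local Open Scope classical_set_scope.
Local Open Scope card_scope.

(** * Words: inverses, geodesics and normal forms *)

Lemma linvK : involutive linv. Proof. by case. Qed.

Lemma is_a_linv l : is_a (linv l) = is_a l. Proof. by case: l. Qed.

Lemma winv_cat u v : winv (u ++ v) = winv v ++ winv u.
Proof. by rewrite /winv map_cat rev_cat. Qed.

Lemma winv_rcons u l : winv (rcons u l) = linv l :: winv u.
Proof. by rewrite -cats1 winv_cat. Qed.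

Lemma winv_cons l u : winv (l :: u) = rcons (winv u) (linv l).
Proof. by rewrite -cat1s winv_cat cats1. Qed.

Lemma winvK : involutive winv.
Proof. by elim=> // l w IH; rewrite winv_cons winv_rcons IH linvK. Qed.

Lemma clsM u v : cls (u ++ v) = (cls u * cls v)%g.
Proof. by rewrite -psl_mulE. Qed.

Lemma cls_winv u : cls (winv u) = (cls u)^-1%g.
Proof. by rewrite -psl_invE. Qed.

Lemma cls0 : cls [::] = 1%g. Proof. by []. Qed.

Lemma cls_linv l : cls [:: linv l] = (cls [:: l])^-1%g.
Proof. exact: (cls_winv [:: l]). Qed.

(** Being geodesic only constrains adjacent letters, so a word may be cut at a letter kept in both
    pieces. *)
Lemma geodesic_cat u l w :
  geodesic (u ++ l :: w) = geodesic (rcons u l) && geodesic (l :: w).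
Proof.
case: u => [|x u] //=.
by rewrite /geodesic /= cat_path rcons_path /= andbA.
Qed.

Lemma geodesic_rcons2 u l l' :
  geodesic (rcons (rcons u l) l') = geodesic (rcons u l) && (is_a l != is_a l').
Proof. by rewrite -!cats1 -catA /= geodesic_cat /= cats1 /geodesic /= andbT. Qed.

Lemma geodesic_kind u l l' : is_a l = is_a l' ->
  geodesic (rcons u l) = geodesic (rcons u l').
Proof.
by case: u => [//|x u] ll'; rewrite /geodesic /= !rcons_path /= ll'.
Qed.

Lemma geodesic_winv w : geodesic (winv w) = geodesic w.
Proof.
rewrite /geodesic /winv rev_sorted sorted_map; apply: eq_sorted => x y /=.
by rewrite !is_a_linv eq_sym.
Qed.

Lemma geodesic_prefix u v : geodesic (u ++ v) -> geodesic u.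
Proof.
case: u => [//|x u]; rewrite /geodesic /= cat_path.
by case/andP.
Qed.

Lemma geodesic_suffix u v : geodesic (u ++ v) -> geodesic v.
Proof.
by rewrite -geodesic_winv winv_cat => /geodesic_prefix; rewrite geodesic_winv.
Qed.

(* Left multiplication of a geodesic word by a letter, reduced back to a
   geodesic; the word problem is solved by van der Waerden's argument. *)
Definition push (l : letter) (w : word) : word :=
  match l, w with
  | la, la :: w' => w'
  | lb, lB :: w' => w'
  | lb, lb :: w' => lB :: w'
  | lB, lb :: w' => w'
  | lB, lB :: w' => lb :: w'
  | _, _ => l :: w
  end.

Definition nf (w : word) : word := foldr push [::] w.

Lemma geodesic_push l w : geodesic w -> geodesic (push l w).
Proof. by case: l w => [] [|[] [|[] w]]. Qed.

Lemma geodesic_foldr_push u w : geodesic w -> geodesic (foldr push w u).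
Proof. by move=> gw; elim: u => //= l u; apply: geodesic_push. Qed.

Lemma geodesic_nf w : geodesic (nf w).
Proof. exact: geodesic_foldr_push. Qed.

Lemma nf_id w : geodesic w -> nf w = w.
Proof.
elim: w => // l w IH g; rewrite /= -/(nf w) IH; last exact: (@geodesic_suffix [:: l]).
by case: l w g {IH} => [] [|[] w].
Qed.

(** The letters act on geodesic words through [push], and this action respects the defining
    relations. Geodesicity matters: once a leading letter is cancelled, the rest must not begin with
    a letter of the same kind. *)
Lemma foldr_push_weq u v w : weq u v -> geodesic w ->
  foldr push w u = foldr push w v.
Proof.
move=> uv; elim: uv w => {u v} [//|v w _ IH|u v w _ IH1 _ IH2
    |u u' v v' _ IHu _ IHv||||] x gx.
- by rewrite IH.
- by rewrite IH1 // IH2.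
- by rewrite !foldr_cat IHv // IHu // geodesic_foldr_push.
all: by case: x gx => [|[] [|[] x]].
Qed.

Lemma nf_weq u v : weq u v -> nf u = nf v.
Proof. by move=> uv; apply: foldr_push_weq. Qed.

Lemma weq_push l w : weq (l :: w) (push l w).
Proof.
have ctx u v w' : weq u v -> weq (u ++ w') (v ++ w').
  by move=> uv; apply: weq_cat uv (weq_refl _).
have bb : weq [:: lb; lb] [:: lB].
  apply: (@weq_trans _ [:: lB; lb; lb; lb]).
    exact/weq_sym/(ctx [:: lB; lb] [::] [:: lb; lb])/weq_Bb.
  exact: (weq_cat (weq_refl [:: lB]) weq_bbb).
have BB : weq [:: lB; lB] [:: lb].
  apply: (@weq_trans _ [:: lb; lb; lB]).
    exact/weq_sym/(ctx [:: lb; lb] [:: lB] [:: lB])/bb.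
  exact: (weq_cat (weq_refl [:: lb]) weq_bB).
case: l w => [] [|[] w] /=; try exact: weq_refl.
- exact: ctx _ _ _ weq_aa.
- exact: ctx _ _ _ bb.
- exact: ctx _ _ _ weq_bB.
- exact: ctx _ _ _ weq_Bb.
- exact: ctx _ _ _ BB.
Qed.

Lemma weq_nf w : weq w (nf w).
Proof.
elim: w => [|l w IH]; first exact: weq_refl.
by apply: weq_trans (weq_push l (nf w)); apply: (weq_cat (weq_refl [:: l])).
Qed.

Lemma cls_nf w : cls (nf w) = cls w.
Proof. exact/clsP/weq_sym/weq_nf. Qed.

Lemma cls_geodesic (x : PSL2Z) : exists2 w, geodesic w & x = cls w.
Proof.
by exists (nf (repr x)); rewrite ?geodesic_nf ?cls_nf ?cls_repr.
Qed.

(** * Subgroups and cosets *)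

Section Subgroup.
Variable H : set PSL2Z.
Hypothesis sH : is_subgroup H.

Lemma subgroup1 : H 1%g.
Proof. by case: sH; rewrite inE. Qed.

Lemma subgroupF x y : H x -> H y -> H (x / y)%g.
Proof. by case: sH => _ F Hx Hy; rewrite -inE; apply: F; rewrite inE. Qed.

Lemma subgroupV x : H x -> H x^-1%g.
Proof. by move=> Hx; rewrite -[(x^-1)%g]mul1g; apply: subgroupF subgroup1 Hx. Qed.

Lemma subgroupM x y : H x -> H y -> H (x * y)%g.
Proof.
by move=> Hx Hy; rewrite -[y]invgK; apply: subgroupF Hx (subgroupV Hy).
Qed.

Lemma right_coset_eq x y : right_coset H x = right_coset H y <-> H (x / y)%g.
Proof.
split=> [E|Hxy].
  have : right_coset H x x by exists 1%g; [exact: subgroup1|rewrite mul1g].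
  by rewrite E => -[h Hh <-]; rewrite mulgK.
apply/seteqP; split=> _ [h Hh <-].
  by exists (h * (x / y))%g; [exact: subgroupM|rewrite -mulgA mulgVK].
exists (h * (x / y)^-1)%g; first by apply: subgroupM Hh (subgroupV Hxy).
by rewrite invgF -mulgA mulgVK.
Qed.

Lemma right_coset_eq1 x : right_coset H x = right_coset H 1%g <-> H x.
Proof. by rewrite right_coset_eq divg1. Qed.

End Subgroup.

Lemma right_cosetM (H : set PSL2Z) x y :
  right_coset H (x * y)%g = (fun z => z * y)%g @` right_coset H x.
Proof.
apply/seteqP; split=> [_ [h Hh <-]|_ [_ [h Hh <-] <-]].
  by exists (h * x)%g; [exists h|rewrite mulgA].
by exists h; rewrite // mulgA.
Qed.

Lemma right_coset_mulr (H : set PSL2Z) x x' y :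
  right_coset H x = right_coset H x' ->
  right_coset H (x * y)%g = right_coset H (x' * y)%g.
Proof. by rewrite !right_cosetM => ->. Qed.

(** * Walks *)

Lemma walk_cat V (G : graph V) x u w y :
  walk G x (u ++ w) y <-> exists2 z, walk G x u z & walk G z w y.
Proof.
elim: u x => [|l u IH] x /=.
  by split=> [wxy|[z <-]//]; exists x.
split=> [[z xz /IH [t zt ty]]|[t [z xz zt] ty]].
  by exists t => //; exists z.
by exists z => //; apply/IH; exists t.
Qed.

Lemma walk1 V (G : graph V) x l y : walk G x [:: l] y <-> step G l (x, y).
Proof. by split=> [[z xz <-]|xy] //; exists y. Qed.

Lemma walk_rcons V (G : graph V) x u l y :
  walk G x (rcons u l) y <-> exists2 z, walk G x u z & step G l (z, y).
Proof.
by rewrite -cats1 walk_cat; split=> -[z xz /walk1 zy]; exists z => //; apply/walk1.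
Qed.

Section PslGraph.
Variables (V : Type) (G : graph V).
Hypothesis GG : psl_graph G.

Lemma step_sym l x y : step G l (x, y) -> step G (linv l) (y, x).
Proof. by case: l => //; apply: psl_a_sym. Qed.

Lemma step_fun l x y z : step G l (x, y) -> step G l (x, z) -> y = z.
Proof.
case: l => /=; first exact: psl_a_unique.
  exact: psl_b_fun.
exact: psl_b_inj.
Qed.

Lemma step_inj l x y z : step G l (x, z) -> step G l (y, z) -> x = y.
Proof. by move=> /step_sym xz /step_sym yz; apply: step_fun xz yz. Qed.

(** Followed by another b-edge, the first edge is either a loop or lies in a triangle, which
    determinism identifies with the given path. *)
Lemma step_triangle l x y z : ~~ is_a l ->
  step G l (x, y) -> step G l (y, z) -> step G l (z, x).
Proof.
have b3 u v w : bedge G (u, v) -> bedge G (v, w) -> bedge G (w, u).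
  move=> uv vw; case: (psl_b_shape GG uv) => /=.
  - move=> E; move: uv vw; rewrite E => vv vw.
    by rewrite -{1}(psl_b_fun GG vv vw).
  - case=> _ /= nuv /(_ _ vw) /= iso; case: nuv.
    by have [] : (v, w) = (u, v) by apply: iso; apply: Or42.
  - by case=> t [_ [_ /= vt tu]]; rewrite (psl_b_fun GG vw vt).
case: l => //= _; first exact: b3.
by move=> yx zy; apply: b3 zy yx.
Qed.

Lemma walk_winv x w y : walk G x w y -> walk G y (winv w) x.
Proof.
elim: w x => [|l w IH] x /= => [->//|[z xz /IH zy]].
by rewrite winv_cons; apply/walk_rcons; exists z; last exact: step_sym.
Qed.

Lemma walk_fun w x y z : walk G x w y -> walk G x w z -> y = z.
Proof.
elim: w x => [|l w IH] x /= => [<-//|[t xt ty] [t' xt' tz]].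
by apply: IH ty _; rewrite (step_fun xt xt').
Qed.

(** Cancelling letters lead back to their start because steps are deterministic; a doubled b-letter
    is replaced by the third side of its triangle, read backwards. *)
Lemma walk_push x l w y : walk G x (l :: w) y -> walk G x (push l w) y.
Proof.
have back m m' t u : m' = linv m -> step G m (x, t) -> step G m' (t, u) -> x = u.
  by move=> -> /step_sym tx tu; apply: step_fun tx tu.
have fwd m m' t u : ~~ is_a m -> m' = linv m -> step G m (x, t) ->
    step G m (t, u) -> step G m' (x, u).
  by move=> nm -> xt tu; apply/step_sym/(step_triangle nm xt tu).
case: l w => [] [|[] w] //= [z xz [t zt ty]].
- by rewrite (back la la _ _ _ xz zt).
- by exists t => //; apply: (fwd lb lB _ _ _ _ xz zt).
- by rewrite (back lb lB _ _ _ xz zt).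
- by rewrite (back lB lb _ _ _ xz zt).
- by exists t => //; apply: (fwd lB lb _ _ _ _ xz zt).
Qed.

Lemma walk_nf x w y : walk G x w y -> walk G x (nf w) y.
Proof.
elim: w x => [//|l w IH] x [z xz zy]; apply: (@walk_push x l (nf w)).
by exists z => //; apply: IH.
Qed.

(** Both walks reduce to walks labeled by the same normal form. *)
Lemma walk_cls u w x y z : cls u = cls w -> walk G x u y -> walk G x w z -> y = z.
Proof.
by move=> /clsP/nf_weq E /walk_nf xy /walk_nf xz; apply: walk_fun xz; rewrite -E.
Qed.

End PslGraph.

(** * Entering the vertices of a reduced graph by geodesics *)

Lemma inj_closed_preim (T : finType) (f : T -> T) (R : T -> Prop) :
  injective f -> (forall x, R x -> R (f x)) -> forall x, R (f x) -> R x.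
Proof.
(* The orbits of an injection of a finite type are cycles, so its inverse is an iterate of [f] at
   each point. *)
move=> injf Rf x Rfx; rewrite -(finv_f injf x) /finv.
by elim: (order f (f x)).-1 => //= n; apply: Rf.
Qed.

Section Reduced.
Variables (V : finType) (G : graph V) (v : V).
Hypothesis rG : rooted_reduced G v.
Hypothesis vG : verts G = setT.

Let GG : psl_graph G. Proof. by case: rG. Qed.

(** Here [l] is a possible next letter: it must be able to follow [u], but need not label an edge at
    [x]. *)
Definition entry l x := exists2 u, geodesic (rcons u l) & walk G v u x.

Lemma entry_kind l l' x : is_a l = is_a l' -> entry l x -> entry l' x.
Proof. by move=> ll' [u gu vu]; exists u; rewrite // -(geodesic_kind _ ll'). Qed.

Lemma entry_root l : entry l v. Proof. by exists [::]. Qed.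

Lemma entry_step l l' x y : step G l (x, y) -> is_a l != is_a l' ->
  entry l x -> entry l' y.
Proof.
move=> xy ll' [u gu vx]; exists (rcons u l); last by apply/walk_rcons; exists x.
by rewrite geodesic_rcons2 gu.
Qed.

(* A total version of the partial map "follow the letter l": at the end of an
   isolated edge one goes back, at a missing edge one stays put. *)
Definition nbr l (x : V) : V :=
  xget (xget x [set y | step G (linv l) (x, y)]) [set y | step G l (x, y)].

Lemma nbrP l x :
  [\/ step G l (x, nbr l x),
      (forall y, ~ step G l (x, y)) /\ step G (linv l) (x, nbr l x) |
      (forall y, ~ step G l (x, y)) /\ (forall y, ~ step G (linv l) (x, y))
        /\ nbr l x = x].
Proof.
rewrite /nbr; case: xgetP => [y _ ? |no1]; first exact: Or31.
case: xgetP => [y _ ?|no2]; first exact: Or32.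
exact: Or33.
Qed.

Lemma nbr_inj l : injective (nbr l).
Proof.
(* These hypotheses clash: for an a-letter, [y] has an [l]-edge to [z]; for a b-letter, the steps
   from [x] to [z] to [y] close up and give [y] an [l]-edge to [x]. *)
have key x y z : step G l (x, z) -> step G (linv l) (y, z) ->
    (forall t, ~ step G l (y, t)) -> x = y.
  case a : (is_a l).
    by case: l a => //= _ xz yz /(_ z).
  move=> xz /(step_sym GG); rewrite linvK => zy /(_ x) [].
  by apply: step_triangle xz zy; rewrite // a.
have stuck x y : (forall t, ~ step G l (y, t)) ->
    (forall t, ~ step G (linv l) (y, t)) ->
    step G l (x, y) \/ step G (linv l) (x, y) -> x = y.
  move=> n1 n2 [/(step_sym GG) yx|/(step_sym GG)]; first by case: (n2 x).
  by rewrite linvK => /n1.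
move=> x y.
case: (nbrP l x) => [sx|[nx sx]|[nx [nx' ->]]];
  case: (nbrP l y) => [sy|[ny sy]|[ny [ny' ->]]] E.
- by apply: step_inj sx _ => //; rewrite E.
- by rewrite -E in sy; apply: key sx sy ny.
- by rewrite E in sx; apply: stuck => //; left.
- by rewrite E in sx; apply/esym/(key _ _ _ sy sx nx).
- by apply: step_inj sx _ => //; rewrite E.
- by rewrite E in sx; apply: stuck => //; right.
- by rewrite -E in sy; apply/esym/stuck => //; left.
- by rewrite -E in sy; apply/esym/stuck => //; right.
- exact: E.
Qed.

(** Where [nbr] stays put an edge is missing, so by reducedness the vertex is the root, which the
    empty walk enters whatever letter comes next. *)
Lemma entry_nbr l l' x : is_a l != is_a l' -> entry l x -> entry l' (nbr l x).
Proof.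
move=> ll' ex; case: (nbrP l x) => [|[_]|[no [no' ->]]].
- by move/entry_step; apply.
- by move/entry_step; apply; rewrite ?is_a_linv //; apply: entry_kind ex;
  rewrite is_a_linv.
- have [->|/eqP xv] := eqVneq x v; first exact: entry_root.
  case: rG => _ _ /(_ x); rewrite vG => /(_ I xv) [[y xy] [z xz]].
  case: l no no' {ll' ex} => /= no no'; first by case: (no y).
    by case: xz => [/no|/no'].
  by case: xz => [/no'|/no].
Qed.

(* States are pairs (vertex, whether the next letter is a); following [la] and
   the b-letter l alternately permutes them, so the set of states entered from
   the root is also closed under going backwards. *)
Lemma entry_nbr_inv l x : entry (if is_a l then lb else la) (nbr l x) ->
  entry l x.
Proof.
(* The b-letter of the alternation is [l] itself when possible, so that [T] moves the state
   [(x, is_a l)] along [l]. *)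
pose m := if is_a l then lb else l.
pose T (s : V * bool) := if s.2 then (nbr la s.1, false) else (nbr m s.1, true).
pose R (s : V * bool) := entry (if s.2 then la else lb) s.1.
have mb : is_a m = false by rewrite /m; case: (l).
have Tinj : injective T.
  by move=> [x1 []] [x2 []] // [] /nbr_inj ->.
have RT s : R s -> R (T s).
  case: s => y []; rewrite /R /T /= => ey; first exact: entry_nbr ey.
  by apply: entry_nbr; rewrite ?mb //; apply: entry_kind ey.
move=> e; have := @inj_closed_preim _ T R Tinj RT (x, is_a l).
rewrite /R /T /= /m.
case: l e {m T R mb Tinj RT} => /= e /(_ e) //.
exact: entry_kind.
Qed.

Lemma step_nbr l x y : step G l (x, y) -> nbr l x = y.
Proof.
by move=> xy; case: (nbrP l x) => [xn|[/(_ y)]|[/(_ y)]] //; apply: step_fun xn xy.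
Qed.

(** This puts every edge of [G] on a geodesic loop: enter both of its ends with the letter of the
    edge next. *)
Lemma entryT l x : entry l x.
Proof.
have [w] : exists w, walk G v w x by apply: (psl_connected GG); rewrite vG.
elim/last_ind: w x l => [|w m IH] x l; first by move=> /= <-; apply: entry_root.
move=> /walk_rcons [y vy yx].
have [ll|ll] := eqVneq (is_a m) (is_a l); last exact: entry_step yx ll (IH _ _ vy).
(* The letter [m] has the kind of [l], so appending it does not help. Instead [y] is the neighbor of
   [x] along [linv m], and the entry at [y] is pulled back to [x]. *)
apply: (@entry_kind (linv m)); first by rewrite is_a_linv.
by apply: entry_nbr_inv; rewrite (step_nbr (step_sym GG yx)); apply: IH vy.
Qed.

End Reduced.

(** * Schreier and Stallings graphs *)

Lemma schreier_step (H : set PSL2Z) l g X :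
  step (schreier H) l (right_coset H g, X) <->
  X = right_coset H (g * cls [:: l])%g.
Proof.
have gB : cls [:: lB] = gen_b^-1%g by rewrite (cls_linv lb).
case: l => /=.
- split=> [[g' _ [E <-]]|->]; first exact: right_coset_mulr.
  by exists g.
- split=> [[g' _ [E <-]]|->]; first exact: right_coset_mulr.
  by exists g.
rewrite gB; split=> [[g' _ [<- E]]|->].
  by rewrite -(right_coset_mulr _ E) mulgK.
by exists (g / gen_b)%g; rewrite // mulgVK.
Qed.

Lemma schreier_walk (H : set PSL2Z) g w X :
  walk (schreier H) (right_coset H g) w X <-> X = right_coset H (g * cls w)%g.
Proof.
elim: w g X => [|l w IH] g X /=; first by rewrite cls0 mulg1; split=> ->.
rewrite -cat1s clsM mulgA; split.
  by case=> z /schreier_step -> /IH.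
by move=> ->; exists (right_coset H (g * cls [:: l])%g);
  [apply/schreier_step|apply/IH].
Qed.

Lemma schreier_walk1 (H : set PSL2Z) w X :
  walk (schreier H) (right_coset H 1%g) w X <-> X = right_coset H (cls w).
Proof. by rewrite schreier_walk mul1g. Qed.

Section Stallings.
Variable H : set PSL2Z.
Hypothesis sH : is_subgroup H.

Lemma on_loopE w x y : on_loop H w x y <->
  exists u v, [/\ geodesic (u ++ w ++ v), H (cls (u ++ w ++ v)),
    x = right_coset H (cls u) & y = right_coset H (cls (u ++ w))].
Proof.
split=> -[u [v [guv Huv]]].
  move=> /schreier_walk1 -> /schreier_walk -> _.
  by exists u, v; split; rewrite // clsM.
move=> -> ->; exists u, v; split=> //; first exact/schreier_walk1.
  by apply/schreier_walk; rewrite clsM.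
by apply/schreier_walk; rewrite -clsM -catA; apply/esym/right_coset_eq1.
Qed.

Lemma right_coset_cat u v : H (cls (u ++ v)) ->
  right_coset H (cls u) = right_coset H (cls (winv v)).
Proof.
by move=> Huv; apply/right_coset_eq; rewrite // -cls_winv winvK -clsM.
Qed.

Lemma on_loop_sym l x y : on_loop H [:: l] x y -> on_loop H [:: linv l] y x.
Proof.
move=> /on_loopE [u [v [guv Huv -> ->]]]; apply/on_loopE.
have E : winv v ++ [:: linv l] ++ winv u = winv (u ++ [:: l] ++ v).
  by rewrite !winv_cat -catA.
exists (winv v), (winv u); rewrite E geodesic_winv cls_winv; split=> //.
- exact: subgroupV.
- by apply: right_coset_cat; rewrite -catA.
- have -> : winv v ++ [:: linv l] = winv (l :: v) by rewrite winv_cons cats1.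
  exact: right_coset_cat.
Qed.

(** Reading loops backwards merges the two alternatives in the definition of the edges. *)
Lemma stallings_stepE l x y :
  step (stallings H) l (x, y) <-> on_loop H [:: l] x y.
Proof.
case: l => /=.
- by split=> [[//|/on_loop_sym]|]; last by left.
- by split=> [[//|/on_loop_sym]|]; last by left.
- by split=> [[/on_loop_sym//|//]|]; last by right.
Qed.

(* A coset reached by a geodesic path which a letter of the kind of l may
   extend geodesically. *)
Definition reach l x :=
  exists2 u, geodesic (rcons u l) & x = right_coset H (cls u).

Lemma reach_kind l l' x : is_a l = is_a l' -> reach l x -> reach l' x.
Proof. by move=> ll' [u gu ->]; exists u; rewrite // -(geodesic_kind _ ll'). Qed.

(** A geodesic [u] into [x] and a geodesic [u'] into [y], both extendable by the kind of [l],
    combine into the geodesic loop [u], [l], [winv u']. *)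
Lemma on_loop_step l x y : on_loop H [:: l] x y <->
  [/\ step (schreier H) l (x, y), reach l x & reach l y].
Proof.
split=> [/on_loopE[u [v [guv Huv -> ->]]]|].
  split.
  - by apply/schreier_step; rewrite clsM.
  - exists u => //; rewrite -cats1; apply: (@geodesic_prefix _ v).
    by rewrite -catA.
  apply: (@reach_kind (linv l)); first by rewrite is_a_linv.
  exists (winv v); last by apply: right_coset_cat; rewrite -catA.
  by rewrite -winv_cons geodesic_winv; apply: geodesic_suffix guv.
move=> [xy [u gu Ex] [u' gu' Ey]]; move: xy; rewrite Ex => /schreier_step E.
rewrite -clsM in E.
apply/on_loopE; exists u, (winv u'); split=> //.
- rewrite geodesic_cat gu -(linvK l) -winv_rcons geodesic_winv.
  by rewrite (geodesic_kind _ (is_a_linv l)).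
- rewrite catA clsM cls_winv; apply/right_coset_eq => //.
  by rewrite -E -Ey.
Qed.

Lemma stallings_step l x y : step (stallings H) l (x, y) <->
  [/\ step (schreier H) l (x, y), reach l x & reach l y].
Proof. by rewrite stallings_stepE on_loop_step. Qed.

Lemma reach_two l l' x : is_a l != is_a l' -> reach l x -> reach l' x ->
  forall m, reach m x.
Proof.
move=> ll' rl rl' m; have [e|ne] := eqVneq (is_a l) (is_a m).
  exact: reach_kind rl.
by apply: reach_kind rl'; case: (l) (l') (m) ll' ne => [] [] [].
Qed.

Lemma reach_root l : reach l (right_coset H 1%g).
Proof. by exists [::]. Qed.

Lemma stallings_vert x : verts (stallings H) x <-> forall l, reach l x.
Proof.
split=> [/on_loopE[u [v [guv Huv Ex _]]] m|rx]; last first.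
  (* If nonempty, [u] ends in a b-letter and [u'] in [la], so [u ++ winv u'] alternates at the
     junction. *)
  have [u gu Ex] := rx la; have [u' gu' Ex'] := rx lb.
  apply/on_loopE; exists u, (winv u'); rewrite cats0; split=> //; last first.
    by rewrite /= clsM cls_winv; apply/right_coset_eq; rewrite // -Ex -Ex'.
  case/lastP: u' gu' {Ex'} => [|u' l'] gu'.
    by rewrite cats0; apply: geodesic_prefix (u) [:: la] _; rewrite cats1.
  rewrite winv_rcons /= geodesic_cat -winv_rcons geodesic_winv.
  move: gu'; rewrite geodesic_rcons2 => /andP[-> /= l'b]; rewrite andbT.
  rewrite -(geodesic_kind _ (_ : is_a la = _)) // is_a_linv.
  by case: (l') l'b.
case/lastP: u guv Huv Ex => [|u l]; first by move=> _ _ ->; apply: reach_root.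
case: v => [|l' v] guv Huv ->.
  have -> : right_coset H (cls (rcons u l)) = right_coset H 1%g.
    by apply/right_coset_eq1; move: Huv; rewrite /= cats0.
  exact: reach_root.
(* The vertex lies between the letters [l] and [l'] of the loop: the prefix can be extended by the
   kind of [l'], and the reversed suffix by the kind of [l], which is the other one. *)
move: (guv); rewrite /= geodesic_cat geodesic_rcons2 => /andP[/andP[gu ll'] gv].
apply: (@reach_two (linv l') (linv l)).
- by rewrite !is_a_linv eq_sym.
- apply: (@reach_kind l'); first by rewrite is_a_linv.
  by exists (rcons u l); rewrite // geodesic_rcons2 gu.
- exists (winv (l' :: v)); last exact: right_coset_cat.
  rewrite -winv_cons geodesic_winv; apply: (@geodesic_suffix u).
  by rewrite -cat_rcons.
Qed.

Lemma stallings_root : verts (stallings H) (right_coset H 1%g).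
Proof. by apply/stallings_vert => l; apply: reach_root. Qed.

Lemma reach_step l l' x y : is_a l != is_a l' -> step (schreier H) l (x, y) ->
  reach l x -> reach l' y.
Proof.
move=> ll' xy [u gu Ex]; move: xy; rewrite Ex => /schreier_step ->.
by exists (rcons u l); rewrite ?geodesic_rcons2 ?gu // -cats1 clsM.
Qed.

Lemma schreier_sym l x y : step (schreier H) l (x, y) ->
  step (schreier H) (linv l) (y, x).
Proof.
case: l => //= -[g _ [<- <-]]; exists (g * gen_a)%g => //.
by rewrite -mulgA -clsM (_ : cls _ = 1%g) ?mulg1 //; apply/clsP/weq_aa.
Qed.

Lemma stallings_step_sym l x y : step (stallings H) l (x, y) ->
  step (stallings H) (linv l) (y, x).
Proof.
rewrite !stallings_step => -[/schreier_sym xy rx ry].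
by split=> //; [apply: reach_kind ry|apply: reach_kind rx]; rewrite is_a_linv.
Qed.

Lemma stallings_ends l x y : step (stallings H) l (x, y) ->
  verts (stallings H) x /\ verts (stallings H) y.
Proof.
have half m z t : step (stallings H) m (z, t) -> verts (stallings H) t.
  move=> /stallings_step [zt rz rt]; apply/stallings_vert.
  (* The end [t] is already reached with the kind of [m] next; appending [m] to a path into [z]
     reaches it with the other kind next. *)
  pose m' := if is_a m then lb else la.
  have mm' : is_a m != is_a m' by rewrite /m'; case: (m).
  exact: reach_two mm' rt (reach_step mm' zt rz).
by move=> xy; split; [apply: half (stallings_step_sym xy)|apply: half xy].
Qed.

Lemma stallings_loop_walk u v : geodesic (u ++ v) -> H (cls (u ++ v)) ->
  walk (stallings H) (right_coset H 1%g) u (right_coset H (cls u)).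
Proof.
elim/last_ind: u v => [|u l IH] v; first by [].
rewrite cat_rcons => guv Huv; apply/walk_rcons.
exists (right_coset H (cls u)); first exact: IH guv Huv.
by apply/stallings_stepE/on_loopE; exists u, v; rewrite cats1.
Qed.

Lemma stallings_walk_schreier x w y : walk (stallings H) x w y ->
  walk (schreier H) x w y.
Proof.
elim: w x => //= l w IH x [z /stallings_step [xz _ _] /IH zy].
by exists z.
Qed.

Lemma stallings_closed_walk w :
  walk (stallings H) (right_coset H 1%g) w (right_coset H 1%g) -> H (cls w).
Proof.
move/stallings_walk_schreier/schreier_walk1 => E.
by apply/right_coset_eq1; rewrite // -E.
Qed.

Lemma stallings_vert_walk x : verts (stallings H) x ->
  exists w, walk (stallings H) (right_coset H 1%g) w x.
Proof.
move=> /on_loopE[u [v [guv Huv -> _]]]; exists u.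
exact: stallings_loop_walk Huv.
Qed.

Lemma stallings_walk_winv x w y : walk (stallings H) x w y ->
  walk (stallings H) y (winv w) x.
Proof.
elim: w x => [|l w IH] x /= => [->//|[z xz /IH zy]].
by rewrite winv_cons; apply/walk_rcons; exists z; last exact: stallings_step_sym.
Qed.

Lemma stallings_fun l x y z : step (stallings H) l (x, y) ->
  step (stallings H) l (x, z) -> y = z.
Proof.
move=> /stallings_step [xy [u _ Ex] _] /stallings_step [xz _ _].
by move: xy xz; rewrite Ex => /schreier_step -> /schreier_step ->.
Qed.

(** The relation b^3 = 1 closes the triangle in the Schreier graph, and both ends of the third edge
    are already reached with a b-letter next. *)
Lemma stallings_triangle x y z : bedge (stallings H) (x, y) ->
  bedge (stallings H) (y, z) -> bedge (stallings H) (z, x).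
Proof.
move=> /(@stallings_step lb) [xy [u gu Ex] ry] /(@stallings_step lb) [yz _ rz].
apply/(@stallings_step lb); split=> //; last by exists u.
move: xy yz; rewrite Ex => /schreier_step -> /schreier_step ->.
have b3 : (cls [:: lb] * (cls [:: lb] * cls [:: lb]) = 1)%g.
  by rewrite -!clsM; apply/clsP/weq_bbb.
by apply/schreier_step; rewrite -!mulgA b3 mulg1.
Qed.

Lemma stallings_psl : finite_set (verts (stallings H)) ->
  psl_graph (stallings H).
Proof.
move=> fin; split=> //.
- move=> x y /stallings_vert_walk [u /stallings_walk_winv xu].
  move=> /stallings_vert_walk [w wy].
  by exists (winv u ++ w); apply/walk_cat; exists (right_coset H 1%g).
- exact: stallings_ends.
- by move=> x y /(@stallings_step_sym la).
- by move=> x y z; apply: (@stallings_fun la).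
- by move=> x y z; apply: (@stallings_fun lb).
- by move=> x y z; apply: (@stallings_fun lB).
move=> [x y] /= xy.
have [->|nxy] := pselect (x = y); first exact: Or31.
have bfun := @stallings_fun lb; have binj := @stallings_fun lB.
(* A coincidence of [z] with [x] or [y] would create a b-loop there, forcing [x = y]. *)
have tri z : bedge (stallings H) (y, z) -> triangle_bedge (stallings H) (x, y).
  move=> yz; have zx := stallings_triangle xy yz.
  exists z; split; split=> // E; apply: nxy.
    have yy : bedge (stallings H) (y, y) by rewrite {2}(E : y = z).
    exact: (binj y x y xy yy).
  have xx : bedge (stallings H) (x, x) by rewrite -{1}(E : z = x).
  exact: (bfun x x y xx xy).
have [[z yz]|no] := pselect (exists z, bedge (stallings H) (y, z)).
  exact/Or33/tri/yz.
(* No edge leaves [y]. An edge into [x] would produce one by closing the triangle, and the remaining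
   ways of sharing an end are settled by determinism. *)
apply: Or32; split=> // -[x' y'] /= xy' [] E; subst.
- by rewrite (bfun _ _ _ xy xy').
- by case: no; exists y'.
- by case: no; exists x'; apply: stallings_triangle xy' xy.
- by rewrite (binj _ _ _ xy xy').
Qed.

Lemma stallings_reduced : finite_set (verts (stallings H)) ->
  rooted_reduced (stallings H) (right_coset H 1%g).
Proof.
move=> fin; split; [exact: stallings_psl|exact: stallings_root|].
move=> x /stallings_vert rx xr.
(* A path into a non-root vertex is nonempty; if [l] can follow it, its last letter, read backwards,
   is an edge of the other kind at [x]. *)
have edge l : exists2 l', is_a l' != is_a l &
    exists y, step (stallings H) l' (x, y).
  have [u gu Ex] := rx l; case/lastP: u gu Ex => [_ /xr//|u m].
  rewrite geodesic_rcons2 => /andP[gu ml] Ex.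
  have yx : step (schreier H) m (right_coset H (cls u), x).
    by apply/schreier_step; rewrite -clsM cats1.
  exists (linv m); first by rewrite is_a_linv.
  exists (right_coset H (cls u)); apply/stallings_step_sym/stallings_step.
  by split=> //; exists u.
split.
  by have [[] // _ [y xy]] := edge lb; exists y.
by have [[] // _ [y xy]] := edge la; exists y; [left|right].
Qed.

End Stallings.

(** * The subgroup of a rooted graph *)

(** At [x = v] this is the subgroup defined by the rooted graph; for general [x] it is the Stallings
    vertex that corresponds to [x]. *)
Definition loop_coset V (G : graph V) (v x : V) : set PSL2Z :=
  [set g | exists2 w, walk G v w x & cls w = g].

(** For a bijection [f] from [V] onto the vertices of [G], this is [G] relabeled by [V]. *)
Definition pull V W (f : V -> W) (G : graph W) : graph V :=
  Graph [set x | verts G (f x)] [set e | aedge G (f e.1, f e.2)]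
        [set e | bedge G (f e.1, f e.2)].

Lemma step_pull V W (f : V -> W) (G : graph W) l x y :
  step (pull f G) l (x, y) <-> step G l (f x, f y).
Proof. by case: l. Qed.

Lemma graph_ext V (G G' : graph V) : verts G = verts G' ->
  (forall l x y, step G l (x, y) <-> step G' l (x, y)) -> G = G'.
Proof.
case: G G' => [vs aes bes] [vs' aes' bes'] /= -> E; congr Graph.
  by apply/seteqP; split=> -[x y] /(E la).
by apply/seteqP; split=> -[x y] /(E lb).
Qed.

Lemma is_subgroupP (H : set PSL2Z) : H 1%g ->
  (forall x y, H x -> H y -> H (x / y)%g) -> is_subgroup H.
Proof.
by move=> H1 HF; split; [rewrite inE|move=> x y; rewrite !inE; apply: HF].
Qed.

Lemma smallest_subgroup (S : set PSL2Z) : is_subgroup (smallest is_subgroup S).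
Proof.
apply: is_subgroupP => [K [sK _]|x y Sx Sy K KS]; first exact: subgroup1.
by apply: subgroupF; [case: KS|apply: Sx|apply: Sy].
Qed.

Section LoopSubgroup.
Variables (V : finType) (G : graph V) (v : V).
Hypothesis rG : rooted_reduced G v.
Hypothesis vG : verts G = setT.

Let GG : psl_graph G. Proof. by case: rG. Qed.
Let H := loop_coset G v v.

Lemma loop_subgroup : is_subgroup H.
Proof.
apply: is_subgroupP => [|_ _ [u vu <-] [w vw <-]]; first by exists [::].
exists (u ++ winv w); last by rewrite clsM cls_winv.
by apply/walk_cat; exists v => //; apply: walk_winv.
Qed.
Let sH := loop_subgroup.

Lemma root_walk x : exists w, walk G v w x.
Proof. by apply: (psl_connected GG); rewrite vG. Qed.

Lemma loop_cosetE w x : walk G v w x -> loop_coset G v x = right_coset H (cls w).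
Proof.
move=> vx; apply/seteqP; split=> [_ [u vu <-]|_ [_ [u vu <-] <-]].
  exists (cls (u ++ winv w)); last by rewrite clsM cls_winv mulgVK.
  exists (u ++ winv w) => //; apply/walk_cat; exists x => //.
  exact: walk_winv.
by exists (u ++ w); [apply/walk_cat; exists v|rewrite clsM].
Qed.

(** Equal cosets share a group element, and the element alone determines where a walk from the root
    ends. *)
Lemma loop_coset_inj : injective (loop_coset G v).
Proof.
move=> x y E; have [w vw] := root_walk x.
have : loop_coset G v x (cls w) by exists w.
by rewrite E => -[u vu uw]; apply/esym/(walk_cls GG uw vu vw).
Qed.

(** Some closed walk carries a label equal to [w] in the group; its normal form is [w] itself. *)
Lemma geodesic_loop_walk w : geodesic w -> H (cls w) -> walk G v w v.
Proof.
by move=> gw [u vu /clsP/nf_weq E]; rewrite -(nf_id gw) -E; apply: walk_nf.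
Qed.

Lemma loop_coset_step l x y : step G l (x, y) ->
  step (schreier H) l (loop_coset G v x, loop_coset G v y).
Proof.
move=> xy; have [w vw] := root_walk x; rewrite (loop_cosetE vw).
apply/schreier_step; rewrite -clsM; apply: loop_cosetE.
by rewrite cats1; apply/walk_rcons; exists x.
Qed.

Lemma loop_coset_reach l x : reach H l (loop_coset G v x).
Proof.
have [u gu vu] := entryT rG vG l x.
by exists u; last exact: loop_cosetE.
Qed.

Lemma range_loop_coset : range (loop_coset G v) = verts (stallings H).
Proof.
apply/seteqP; split=> [_ [x _ <-]|X].
  by apply/stallings_vert => // l; apply: loop_coset_reach.
move=> /(on_loopE sH)[u [w [guw Huw -> _]]].
have /walk_cat[x vx _] := geodesic_loop_walk guw Huw.
by exists x; last exact: loop_cosetE.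
Qed.

(** A Stallings edge lies on a geodesic loop, which can also be walked in [G]; conversely [entryT]
    reaches both ends of an edge of [G] with its letter next. *)
Lemma step_stallings_loop l x y :
  step (stallings H) l (loop_coset G v x, loop_coset G v y) <-> step G l (x, y).
Proof.
split=> [/(stallings_stepE sH)/(on_loopE sH)[u [w [guw Huw Ex Ey]]]|xy].
  have /walk_cat[x' vx /walk_cat[y' /walk1 xy yv]] := geodesic_loop_walk guw Huw.
  move: Ex; rewrite -(loop_cosetE vx) => /loop_coset_inj ->.
  move: Ey; rewrite -(@loop_cosetE _ y') => [/loop_coset_inj -> //|].
  by apply/walk_cat; exists x' => //; apply/walk1.
apply/stallings_step => //; split; [exact: loop_coset_step| |];
  exact: loop_coset_reach.
Qed.

Lemma pull_stallings_loop : pull (loop_coset G v) (stallings H) = G.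
Proof.
apply: graph_ext => [|l x y]; last by rewrite step_pull step_stallings_loop.
rewrite vG; apply/seteqP; split=> // x _.
suff : verts (stallings H) (loop_coset G v x) by [].
by rewrite -range_loop_coset; exists x.
Qed.

(* H is generated by the loops p_x l p_y^-1, one for each edge x -l-> y, where
   p_x is a chosen path from the root to x. *)
Lemma loop_fg : finitely_generated H.
Proof.
have [p vp] := choice root_walk.
pose gen (t : V * letter * V) := cls (p t.1.1 ++ t.1.2 :: winv (p t.2)).
(* The chosen closed walk [p v] may be nontrivial, so its class joins the generators. *)
pose S := gen @` [set t | step G t.1.2 (t.1.1, t.2)] `|` [set cls (p v)].
exists S.
  rewrite finite_setU; split; last exact: finite_set1.
  exact/finite_image/finite_finset.
apply/seteqP; split; last first.
  apply: smallest_sub => // _ [[[[x l] y] /= xy <-]|->]; last by exists (p v).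
  exists (p x ++ l :: winv (p y)) => //; apply/walk_cat; exists x => //=.
  by exists y => //; apply: walk_winv.
have sS := smallest_subgroup S.
(* Inserting [winv (p z)] followed by [p z] at each intermediate vertex [z] splits the element into
   generators. *)
have key w x y : walk G x w y ->
    smallest is_subgroup S (cls (p x ++ w ++ winv (p y))).
  elim: w x => [|l w IH] x /= => [->|[z xz zy]].
    by rewrite clsM cls_winv mulgV; apply: subgroup1.
  have -> : cls (p x ++ l :: w ++ winv (p y)) =
      (gen (x, l, z) * cls (p z ++ w ++ winv (p y)))%g.
    rewrite /gen /= -[l :: w ++ _]cat1s -[l :: winv _]cat1s !clsM !cls_winv.
    by rewrite !mulgA mulgVK.
  by apply: subgroupM (IH _ zy) => //; apply: sub_gen_smallest; left; exists (x, l, z).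
move=> _ [w vw <-]; have Sv : smallest is_subgroup S (cls (p v)).
  by apply: sub_gen_smallest; right.
have -> : cls w = ((cls (p v))^-1 * cls (p v ++ w ++ winv (p v)) * cls (p v))%g.
  by rewrite !clsM cls_winv !mulgA mulVg mul1g mulgVK.
by do 2!apply: (subgroupM sS) => //; [exact: subgroupV sS _ _|exact: key].
Qed.

End LoopSubgroup.

(** * Relabeling a graph along a bijection onto its vertices *)

Lemma card_eq_image_II T U (f : T -> U) (A : set T) (B : set U) k :
  injective f -> f @` A = B -> (A #= `I_k) = (B #= `I_k).
Proof. by move=> fi <-; apply/esym/card_eql/inj_card_eq => x y _ _; apply: fi. Qed.

Section Pull.
Variables (V W : Type) (f : V -> W) (G : graph W).
Hypotheses (fi : injective f) (rf : range f = verts G).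
Hypothesis GE : forall l x y, step G l (x, y) -> verts G x /\ verts G y.

Lemma pull_verts : verts (pull f G) = setT.
Proof.
by apply/seteqP; split=> // x _; suff : verts G (f x) by []; rewrite -rf; exists x.
Qed.

Lemma vert_preim y : verts G y -> exists x, y = f x.
Proof. by rewrite -rf => -[x _ <-]; exists x. Qed.

Lemma step_preim l x y : step G l (x, y) -> exists x' y', x = f x' /\ y = f y'.
Proof. by move=> /GE[/vert_preim[x' ->] /vert_preim[y' ->]]; exists x', y'. Qed.

Lemma walk_pull x w y : walk (pull f G) x w y <-> walk G (f x) w (f y).
Proof.
elim: w x => [|l w IH] x /=; first by split=> [->|/fi].
split=> [[z /step_pull xz /IH zy]|[z xz zy]]; first by exists (f z).
have [_ [z' [_ E]]] := step_preim xz; rewrite {}E in xz zy.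
by exists z'; [apply/step_pull|apply/IH].
Qed.

Lemma isolated_pull e :
  isolated_bedge (pull f G) e <-> isolated_bedge G (f e.1, f e.2).
Proof.
case: e => x y; split=> -[/= xy nxy iso]; split=> //=.
- by move/fi.
- move=> [z t] zt; have [z' [t' [E E']]] := @step_preim lb _ _ zt; subst z t.
  move=> /= H; suff [-> ->] : (z', t') = (x, y) by []; apply: iso => //=.
  by case: H => /fi ->; [apply: Or41|apply: Or42|apply: Or43|apply: Or44].
- by move=> E; apply: nxy; rewrite E.
- move=> [z t] /= zt H.
  suff [/fi -> /fi ->] : (f z, f t) = (f x, f y) by []; apply: iso => //=.
  by case: H => ->; [apply: Or41|apply: Or42|apply: Or43|apply: Or44].
Qed.

Lemma pull_psl : psl_graph G -> finite_set [set: V] -> psl_graph (pull f G).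
Proof.
move=> GG fV; split.
- exact: sub_finite_set fV.
- move=> x y vx vy; have [w xwy] := psl_connected GG vx vy.
  by exists w; apply/walk_pull.
- by move=> l x y /step_pull/GE.
- by move=> x y /=; apply: psl_a_sym.
- by move=> x y z /= xy xz; apply/fi/(psl_a_unique GG xy xz).
- by move=> x y z /= xy xz; apply/fi/(psl_b_fun GG xy xz).
- by move=> x y z /= xy xz; apply/fi/(psl_b_inj GG xy xz).
move=> [x y] /= xy; case: (psl_b_shape GG xy) => [/fi E||].
- exact: Or31.
- by move=> h; apply/Or32/isolated_pull.
move=> [z' [[n1 n2 n3] [_ yz zx]]]; have [z [_ [E _]]] := @step_preim lb _ _ zx.
subst z'; apply: Or33; exists z; split; split=> //= E.
- by apply: n1; rewrite /= E.
- by apply: n2; rewrite /= E.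
- by apply: n3; rewrite /= E.
Qed.

Lemma pull_rooted v : rooted_reduced G (f v) -> finite_set [set: V] ->
  rooted_reduced (pull f G) v.
Proof.
move=> [GG vv rG] fV; split=> //; first exact: pull_psl.
move=> x vx xv; have [|[y' xy] [z' xz]] := rG (f x) vx; first by move/fi.
split.
  by have [_ [y [_ E]]] := @step_preim la _ _ xy; exists y; rewrite /= -E.
by case: xz => xz; [have [_ [z [_ E]]] := @step_preim lb _ _ xz
                   |have [z [_ [E _]]] := @step_preim lb _ _ xz];
  exists z; [left|right]; rewrite /= -E.
Qed.

(** Each of the five sets counted for [G] is the image of its counterpart under a map induced by
    [f], hence injective. *)
Lemma pull_type n k2 k3 l2 l3 :
  has_type (pull f G) n k2 k3 l2 l3 <-> has_type G n k2 k3 l2 l3.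
Proof.
pose f2 (e : V * V) := (f e.1, f e.2).
have f2i : injective f2 by move=> [x y] [z t] [/fi -> /fi ->].
have imi : injective (fun A => f @` A).
  move=> A B E; apply/funext => x.
  by rewrite -(image_inj (A := A) fi) -(image_inj (A := B) fi) E.
have e1 : f @` verts (pull f G) = verts G by rewrite pull_verts.
have e2 : (fun A => f @` A) @` [set E : set V | exists x y,
      [/\ aedge (pull f G) (x, y), x <> y & E = [set x; y]]] =
    [set E : set W | exists x y, [/\ aedge G (x, y), x <> y & E = [set x; y]]].
  apply/seteqP; split=> [_ [_ [x [y [xy nxy ->]]] <-]|_ [x' [y' [xy nxy ->]]]].
    exists (f x), (f y); split=> //; first by move/fi.
    by rewrite image_setU !image_set1.
  have [x [y [E E']]] := @step_preim la _ _ xy; subst x' y'.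
  exists [set x; y]; last by rewrite image_setU !image_set1.
  by exists x, y; split=> // E; apply: nxy; rewrite E.
have e3 : f2 @` [set e | isolated_bedge (pull f G) e] =
    [set e | isolated_bedge G e].
  apply/seteqP; split=> [_ [e /isolated_pull ? <-] //|[x' y'] iso].
  have [x [y [E E']]] : exists x y, x' = f x /\ y' = f y.
    by apply: (@step_preim lb); case: iso.
  by subst x' y'; exists (x, y) => //; apply/isolated_pull.
have e4 l : f @` [set x | step (pull f G) l (x, x)] = [set x | step G l (x, x)].
  apply/seteqP; split=> [_ [x /step_pull ? <-] //|x' xx].
  have [x [_ [E _]]] := step_preim xx; subst x'.
  by exists x => //; apply/step_pull.
rewrite /has_type (card_eq_image_II _ fi e1) (card_eq_image_II _ imi e2).
rewrite (card_eq_image_II _ f2i e3) (card_eq_image_II _ fi (e4 la)).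
by rewrite (card_eq_image_II _ fi (e4 lb)).
Qed.

End Pull.

(** * Counting *)

Lemma card_bij_II T (A : set T) n (f : T -> nat) :
  (forall x, A x -> f x < n) ->
  (forall x y, A x -> A y -> f x = f y -> x = y) ->
  (forall i, i < n -> exists2 x, A x & f x = i) -> A #= `I_n.
Proof.
move=> fA finj fsurj; apply/card_set_bijP; exists f; split=> //.
by move=> x y; rewrite !inE; apply: finj.
Qed.

Lemma card_II_bij T (A : set T) n : A #= `I_n -> exists f : T -> nat,
  [/\ forall x, A x -> f x < n,
      forall x y, A x -> A y -> f x = f y -> x = y &
      forall i, i < n -> exists2 x, A x & f x = i].
Proof.
move=> /card_set_bijP[f [fA finj fsurj]]; exists f; split=> //.
by move=> x y Ax Ay; apply: finj; rewrite inE.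
Qed.

Lemma card_setT_fin (T : finType) : [set: T] #= `I_#|T|.
Proof.
apply: (@card_bij_II _ _ _ (fun x => enum_rank x)) => [x _|x y _ _|i ilt].
- exact: ltn_ord.
- by move/ord_inj/enum_rank_inj.
- by exists (enum_val (Ordinal ilt)); rewrite // enum_valK.
Qed.

(** Pairs are numbered by [r x * k + f x y], from which division with remainder by [k] recovers both
    numbers. *)
Lemma card_sigma T U (X : set T) (F : T -> set U) m k : X #= `I_m ->
  (forall x, X x -> F x #= `I_k) -> [set p | X p.1 /\ F p.1 p.2] #= `I_(m * k).
Proof.
move=> /card_II_bij [r [rlt rinj rsurj]] FX.
have : forall x, exists f : U -> nat, X x -> [/\ forall y, F x y -> f y < k,
      forall y z, F x y -> F x z -> f y = f z -> y = z &
      forall i, i < k -> exists2 y, F x y & f y = i].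
  (* Outside [X] the numbering is an arbitrary default. *)
  move=> x; have [Xx|nX] := pselect (X x); last by exists (fun=> 0).
  by have [f fP] := card_II_bij (FX _ Xx); exists f.
move=> /choice[f fP].
apply: (@card_bij_II _ _ _ (fun p => r p.1 * k + f p.1 p.2)).
- move=> [x y] /= [Xx Fxy]; have [flt _ _] := fP x Xx.
  apply: (@leq_trans ((r x).+1 * k)); last by rewrite leq_mul2r rlt ?orbT.
  by rewrite mulSn addnC ltn_add2r flt.
- move=> [x y] [x' y'] /= [Xx Fxy] [Xx' Fxy'] E.
  have [flt finj _] := fP x Xx; have [flt' _ _] := fP x' Xx'.
  have k0 : 0 < k by apply: leq_ltn_trans (flt _ Fxy).
  have := congr1 (divn^~ k) E; rewrite /= !divnMDl // !divn_small ?flt ?flt' //.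
  rewrite !addn0 => /(rinj _ _ Xx Xx') xx'; subst x'.
  by move: E => /addnI/(finj _ _ Fxy Fxy') ->.
- move=> i ilt; have k0 : 0 < k by case: (k) ilt => //; rewrite muln0.
  have [|x Xx Ex] := rsurj (i %/ k); first by rewrite ltn_divLR.
  have [_ _ /(_ (i %% k))[|y Fxy Ey]] := fP x Xx; first by rewrite ltn_mod.
  by exists (x, y) => //=; rewrite Ex Ey -divn_eq.
Qed.

Lemma card_fset_setE (T : choiceType) (A : set T) : finite_set A ->
  A #= `I_#|` fset_set A|%fset.
Proof. by move=> /finite_setP[n An]; rewrite (card_fset_set An). Qed.

Definition labelings T n (A : set T) : set ('I_n -> T) :=
  [set f | injective f /\ range f = A].
Arguments labelings {T} n A.

Lemma labelings_neq0 T n (A : set T) : A #= `I_n -> labelings n A !=set0.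
Proof.
move=> /card_II_bij [r [rlt rinj rsurj]].
have /choice[e eP] : forall i : 'I_n, exists x, A x /\ r x = i.
  by move=> i; have [x Ax rx] := rsurj i (ltn_ord i); exists x.
exists e; split=> [i j E|].
  by apply/ord_inj; rewrite -(eP i).2 -(eP j).2 E.
apply/seteqP; split=> [_ [i _ <-]|x Ax]; first exact: (eP i).1.
exists (Ordinal (rlt _ Ax)) => //.
by apply: rinj => //; [exact: (eP _).1|rewrite (eP _).2].
Qed.

(** Any labeling is a fixed one [e] precomposed with a unique permutation. *)
Lemma card_labelings T n (A : set T) : A #= `I_n -> labelings n A #= `I_(n`!).
Proof.
move=> An; have [e [einj eA]] := labelings_neq0 An.
rewrite -(card_Sn n) -(@card_eq_image_II _ _ (fun (s : 'S_n) i => e (s i)) setT).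
- exact: card_setT_fin.
- by move=> s t E; apply/permP => i; apply: einj; apply: (congr1 (@^~ i) E).
apply/seteqP; split=> [_ [s _ <-]|f [finj fA]].
  split=> [i j /einj/perm_inj //|].
  rewrite -eA; apply/seteqP; split=> _ [i _ <-]; first by exists (s i).
  by exists ((s^-1)%g i); rewrite // permKV.
have /choice[s sP] : forall i, exists j, e j = f i.
  move=> i; have : A (f i) by rewrite -fA; exists i.
  by rewrite -eA => -[j _ <-]; exists j.
have sinj : injective s by move=> i j E; apply: finj; rewrite -!sP E.
by exists (perm sinj) => //; apply/funext => i; rewrite permE.
Qed.

Lemma finite_graphs (T : finType) (A : set (graph T)) : finite_set A.
Proof.
apply: (@sub_finite_set _ _ ((fun t : {set T} * {set T * T} * {set T * T} =>
  Graph [set` t.1.1] [set` t.1.2] [set` t.2]) @` setT)).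
  move=> [vs aes bes] _.
  exists ([set x | `[< vs x >]], [set x | `[< aes x >]],
          [set x | `[< bes x >]])%SET => //=.
  by congr Graph; apply/seteqP; split=> x /=; rewrite inE => /asboolP.
exact/finite_image/finite_finset.
Qed.

Lemma finite_rooted_graphs (T : finType) (A : set (graph T * T)) : finite_set A.
Proof.
apply: (@sub_finite_set _ _ (setT `*` setT)) => //.
by apply: finite_setX; [exact: finite_graphs|exact: finite_finset].
Qed.

(** * Labeled rooted graphs as subgroups with a labeling *)

Section Labelled.
Variables n k2 k3 l2 l3 : nat.

Let L := rooted_reduced_graphs n k2 k3 l2 l3.
Let P := [set p : set PSL2Z * ('I_n -> set PSL2Z) |
  subgroups_of_type n k2 k3 l2 l3 p.1 /\ labelings n (verts (stallings p.1)) p.2].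

Definition coset_labeling (Gv : graph 'I_n * 'I_n) :=
  (loop_coset Gv.1 Gv.2 Gv.2, loop_coset Gv.1 Gv.2).

Lemma coset_labeling_sub Gv : L Gv -> P (coset_labeling Gv).
Proof.
case: Gv => G v [vG rG tG] /=; have sH := loop_subgroup rG.
have inj := loop_coset_inj rG vG; have rng := range_loop_coset rG vG.
split=> //=; split=> //; first exact: loop_fg.
apply/(pull_type inj rng); first exact: stallings_ends.
by rewrite pull_stallings_loop.
Qed.

(** The graph is recovered by pulling the Stallings graph back along the labeling, and the root as
    the vertex labeling the subgroup itself. *)
Lemma coset_labeling_inj Gv Gv' : L Gv -> L Gv' ->
  coset_labeling Gv = coset_labeling Gv' -> Gv = Gv'.
Proof.
case: Gv Gv' => G v [G' v'] [/= vG rG tG] [/= vG' rG' tG'].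
rewrite /coset_labeling /= => -[EH E].
have GG' : G = G'.
  by rewrite -(pull_stallings_loop rG vG) -(pull_stallings_loop rG' vG') EH E.
subst G'; congr pair; apply: (loop_coset_inj rG vG).
by rewrite EH E.
Qed.

Lemma coset_labeling_surj p : P p -> exists2 Gv, L Gv & coset_labeling Gv = p.
Proof.
case: p => H f [/= [sH _ tH] [inj rng]].
have {}rng : range f = verts (stallings H) := rng.
have ends := @stallings_ends H sH.
have fin : finite_set (verts (stallings H)).
  by apply/finite_setP; exists n; case: tH.
have [v vf] := vert_preim rng (stallings_root sH).
pose G := pull f (stallings H).
have vG : verts G = setT by exact: pull_verts.
have rG : rooted_reduced G v.
  apply: (pull_rooted inj rng ends _ finite_finset).
  by rewrite -vf; apply: stallings_reduced.
(* Closed walks at the root of the Stallings graph have labels in [H]; conversely an element of [H]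
   has a geodesic representative, whose loop stays in the Stallings graph. *)
have EH : loop_coset G v v = H.
  apply/seteqP; split=> [_ [w /(walk_pull inj rng ends) + <-]|h Hh].
    by rewrite -vf; apply: stallings_closed_walk.
  have [w gw E] := cls_geodesic h; subst h; exists w => //.
  apply/(walk_pull inj rng ends); rewrite -vf.
  rewrite -[X in walk _ _ _ X](proj2 (right_coset_eq1 sH (cls w))) //.
  by apply: (@stallings_loop_walk H sH w [::]); rewrite cats0.
exists (G, v); first by split=> //=; apply/pull_type.
(* The coset attached to [x] is that of the label of any walk from the root to [x]; in the Schreier
   graph this walk ends at [f x]. *)
rewrite /coset_labeling /= EH; congr pair; apply/funext => x.
have [w vw] := root_walk rG vG x; rewrite (loop_cosetE rG vw) EH.
move: vw => /(walk_pull inj rng ends)/(stallings_walk_schreier sH).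
by rewrite -vf => /schreier_walk1.
Qed.

Lemma image_coset_labeling : coset_labeling @` L = P.
Proof.
apply/seteqP; split=> [_ [Gv LGv <-]|p /coset_labeling_surj //].
exact: coset_labeling_sub.
Qed.

(** Each such subgroup has a labeling of its Stallings graph, so it comes from one of the finitely
    many labeled rooted graphs. *)
Lemma finite_subgroups : finite_set (subgroups_of_type n k2 k3 l2 l3).
Proof.
have -> : subgroups_of_type n k2 k3 l2 l3 = fst @` P.
  apply/seteqP; split=> [H HH|_ [p [? _] <-] //].
  have [_ _ [vn _ _ _ _]] := HH; have [f fP] := labelings_neq0 vn.
  by exists (H, f).
rewrite -image_coset_labeling; do 2!apply: finite_image.
exact: finite_rooted_graphs.
Qed.

Lemma L_count_subgroups :
  L_count n k2 k3 l2 l3 = (H_count n k2 k3 l2 l3 * n`!)%N.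
Proof.
apply: card_fset_set.
have LP : P #= L.
  rewrite -image_coset_labeling; apply: inj_card_eq => x y; rewrite !inE.
  exact: coset_labeling_inj.
rewrite -(card_eql LP).
apply: (@card_sigma _ _ _ (fun H => labelings n (verts (stallings H)))).
  exact/card_fset_setE/finite_subgroups.
by move=> H [_ _ [vn _ _ _ _]]; apply: card_labelings.
Qed.

End Labelled.

(** * Additivity of finite cardinals *)

Lemma card_setU_II (T : choiceType) (A B : set T) m k :
  A #= `I_m -> B #= `I_k -> A `&` B = set0 -> A `|` B #= `I_(m + k).
Proof.
move=> Am Bk AB0; have fA : finite_set A by apply/finite_setP; exists m.
have fB : finite_set B by apply/finite_setP; exists k.
rewrite -(card_fset_set Am) -(card_fset_set Bk).
have <- : #|` fset_set (A `|` B)|%fset =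
    (#|` fset_set A|%fset + #|` fset_set B|%fset)%N.
  by rewrite fset_setU // cardfsU -fset_setI // AB0 fset_set0 cardfs0 subn0.
by apply: card_fset_setE; rewrite finite_setU.
Qed.

Lemma card_eq_II_inj T (A : set T) m k : A #= `I_m -> A #= `I_k -> m = k.
Proof.
by move=> Am Ak; apply/card_eq_II; rewrite -(card_eql Am).
Qed.

Lemma card_setU1_II (T : choiceType) (A : set T) x k : finite_set A ->
  ~ A x -> (A `|` [set x] #= `I_(k + 1)) = (A #= `I_k).
Proof.
move=> /finite_setP[m Am] nAx.
have AxS : A `|` [set x] #= `I_(m + 1).
  apply: card_setU_II Am card_set1 _.
  by apply/seteqP; split=> // y [Ay yx]; apply: nAx; rewrite -yx.
apply/idP/idP => [Ak|Ak].
  by have /eqP := card_eq_II_inj AxS Ak; rewrite eqn_add2r => /eqP <-.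
by rewrite -(card_eq_II_inj Am Ak).
Qed.

(** With at least two vertices there is a walk from [v] to another vertex, and it has a first
    step. *)
Lemma connected_edge n (G : graph 'I_n) v : 1 < n -> connected_graph G ->
  verts G = setT -> exists l z, step G l (v, z).
Proof.
move=> n1 conn vG; have [y yv] : exists y, y != v.
  have [E|] := eqVneq v (Ordinal n1); last by exists (Ordinal n1); rewrite eq_sym.
  by exists (Ordinal (ltnW n1)); rewrite E.
have [||[|l w]] := conn v y; rewrite ?vG //=.
  by move=> E; rewrite E eqxx in yv.
by move=> [z vz _]; exists l, z.
Qed.

(** * Adding a loop (an a-loop if [kind], else a b-loop) at a vertex free of that kind *)

Section AddLoop.
Variables (n : nat) (kind : bool) (G G' : graph 'I_n) (v : 'I_n).
Hypotheses (vG : verts G = setT) (vG' : verts G' = setT).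
Hypothesis free : forall l y, is_a l = kind ->
  ~ step G l (v, y) /\ ~ step G l (y, v).
Hypothesis stepG' : forall l x y,
  step G' l (x, y) <-> step G l (x, y) \/ [/\ is_a l = kind, x = v & y = v].

Let old l x y : step G l (x, y) -> step G' l (x, y).
Proof. by move=> xy; apply/stepG'; left. Qed.

Let bnew e : bedge G' e -> bedge G e \/ e = (v, v) /\ kind = false.
Proof.
by case: e => x y /(@stepG' lb)[|[<- -> ->]]; [left|right].
Qed.

Lemma connected_add_loop : connected_graph G <-> connected_graph G'.
Proof.
split=> conn x y _ _.
  have [||w xwy] := conn x y; rewrite ?vG //.
  exists w; elim: w x xwy => [|l w IH] x //= [z xz zy].
  by exists z; [apply: old|apply: IH].
have [||w] := conn x y; rewrite ?vG' //.
elim: w x => [|l w IH] x /=; first by exists [::].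
move=> [z /stepG' xz /IH[u zy]]; case: xz => [xz|[_ -> zv]].
  by exists (l :: u), z.
by exists u; rewrite -zv.
Qed.

Lemma fun_add_loop l :
  (forall x y z, step G l (x, y) -> step G l (x, z) -> y = z) <->
  (forall x y z, step G' l (x, y) -> step G' l (x, z) -> y = z).
Proof.
split=> F x y z; last by move=> /old xy /old; apply: F xy.
move=> /stepG' [xy|[lk xv ->]] /stepG' [xz|[lk' xv' ->]] //.
- exact: F xy xz.
- by move: xy; rewrite xv' => /(proj1 (free _ lk')).
- by move: xz; rewrite xv => /(proj1 (free _ lk)).
Qed.

Lemma isolated_add_loop e : isolated_bedge G e <-> isolated_bedge G' e.
Proof.
case: e => x y; split=> -[/= xy nxy iso]; split=> //=.
- exact: (@old lb).
- move=> f /bnew[|[-> k]]; first exact: iso.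
  have [nv nv'] := (fun t => proj1 (@free lb t (esym k)),
                    fun t => proj2 (@free lb t (esym k))).
  by move=> /= [] E; subst; [case: (nv y)|case: (nv' x)|case: (nv y)|case: (nv' x)].
- by case/bnew: xy => [//|[[xv yv] _]]; case: nxy; rewrite xv yv.
- by move=> [z t] /(@old lb); apply: iso.
Qed.

Lemma psl_add_loop : psl_graph G <-> psl_graph G'.
Proof.
split=> -[fin conn ends sym afun bfun binj shape]; split.
- by rewrite vG' -vG.
- exact/connected_add_loop.
- by move=> l x y _; rewrite vG'.
- by move=> x y /(@stepG' la)[/sym/(@old la)|[ak -> ->]] //; apply/(@stepG' la); right.
- exact: (proj1 (fun_add_loop la)).
- exact: (proj1 (fun_add_loop lb)).
- by move=> x y z xz yz; apply: (proj1 (fun_add_loop lB) _ z x y xz yz) => a b c;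
  apply: binj.
- move=> [x y] /bnew[/shape[|iso|]|[-> _]] /=.
  + exact: Or31.
  + exact/Or32/isolated_add_loop.
  + move=> [z [ne [xy yz zx]]]; apply: Or33; exists z.
    by do 2!split=> //; apply: (@old lb).
  + exact: Or31.
- by rewrite vG -vG'.
- exact/connected_add_loop.
- by move=> l x y _; rewrite vG.
- move=> x y xy; have /(@stepG' la)[//|[ak xv yv]] := sym _ _ (@old la _ _ xy).
  by move: xy; rewrite xv yv.
- exact: (proj2 (fun_add_loop la)).
- exact: (proj2 (fun_add_loop lb)).
- by move=> x y z xz yz; apply: (proj2 (fun_add_loop lB) _ z x y xz yz) => a b c;
  apply: binj.
- move=> [x y] xy; case: (shape (x, y) (@old lb _ _ xy)) => [|iso|] /=.
  + exact: Or31.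
  + exact/Or32/isolated_add_loop.
  + move=> [z [[n1 n2 n3] [_ yz zx]]]; apply: Or33; exists z; do 2!split=> //.
      by case/bnew: yz => [//|[[yv zv] _]]; case: n2; rewrite /= yv zv.
    by case/bnew: zx => [//|[[zv xv] _]]; case: n3; rewrite /= xv zv.
Qed.

(** The loop gives the root an edge of one kind, and connectedness gives it one of the other.
    Conversely, removing the loop affects only the root, which is exempt. *)
Lemma reduced_add_loop : 1 < n -> rooted_reduced G v <-> cyclically_reduced G'.
Proof.
move=> n1; split=> [[GG vv rG]|[GG' rG']].
  split=> [|x xG']; first exact/psl_add_loop.
  have lift y : on_a_and_b G y -> on_a_and_b G' y.
    move=> [[z yz] [t yt]]; split; first by exists z; apply: (@old la).
    by exists t; case: yt => [/(@old lb)|/(@old lb)]; [left|right].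
  have [->|/eqP xv] := eqVneq x v; last by apply/lift/rG; rewrite ?vG.
  have [l [z vz]] := connected_edge v n1 (psl_connected GG) vG.
  have lk : is_a l != kind.
    by apply/eqP => lk; case: (proj1 (free z lk)).
  have loop m : is_a m = kind -> step G' m (v, v) by move=> mk; apply/stepG'; right.
  move: vz => /old.
  case: l kind lk loop => [] [] //= _ loop vz; split;
    try by exists z; try by [left|right].
  - by exists v; left; apply: (loop lb).
  - by exists v; apply: (loop la).
  - by exists v; apply: (loop la).
split=> //; [exact/psl_add_loop|by rewrite vG|].
move=> x _ xv; have [|[y xy] [z xz]] := rG' x; first by rewrite vG'.
split.
  by exists y; case/(@stepG' la): xy => [//|[_ /xv]].
exists z; case: xz => /(@stepG' lb)[|[_]] //; try by [left|right].
Qed.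

(** A loop is neither a pair of distinct vertices nor an isolated b-edge, so only the count of loops
    of its kind grows. *)
Lemma type_add_loop k2 k3 l2 l3 : has_type G n k2 k3 l2 l3 <->
  has_type G' n k2 k3 (if kind then l2 + 1 else l2) (if kind then l3 else l3 + 1).
Proof.
rewrite /has_type vG vG'.
have -> : [set E : set 'I_n | exists x y,
      [/\ aedge G' (x, y), x <> y & E = [set x; y]]] =
    [set E : set 'I_n | exists x y, [/\ aedge G (x, y), x <> y & E = [set x; y]]].
  apply/seteqP; split=> _ [x [y [xy nxy ->]]]; exists x, y; split=> //.
    by case/(@stepG' la): xy => [//|[_ xv yv]]; case: nxy; rewrite xv yv.
  exact: (@old la).
have -> : [set e | isolated_bedge G' e] = [set e | isolated_bedge G e].
  by apply/seteqP; split=> e; apply isolated_add_loop.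
have loops l : [set x | step G' l (x, x)] = if is_a l == kind
    then [set x | step G l (x, x)] `|` [set v] else [set x | step G l (x, x)].
  apply/seteqP; split=> [x /stepG'|x].
    by case: eqP => [lk [|[_ xv _]]|nlk [|[/nlk]]] //; [left|right].
  case: eqP => [lk [/old //|->]|_ /old //].
  by apply/stepG'; right.
have := loops la; have := loops lb; rewrite /=.
have fv l : is_a l = kind -> ~ step G l (v, v) by move=> lk; apply: (proj1 (free _ lk)).
case: kind fv => fv -> ->.
  by rewrite card_setU1_II //; [exact: finite_finset|exact: (fv la)].
by rewrite card_setU1_II //; [exact: finite_finset|exact: (fv lb)].
Qed.

End AddLoop.

Definition add_loop V (kind : bool) (G : graph V) (v : V) : graph V :=
  Graph (verts G) (aedge G `|` [set e | kind /\ e = (v, v)])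
        (bedge G `|` [set e | ~~ kind /\ e = (v, v)]).

Definition del_loop V (kind : bool) (G : graph V) (v : V) : graph V :=
  Graph (verts G) (aedge G `\` [set e | kind /\ e = (v, v)])
        (bedge G `\` [set e | ~~ kind /\ e = (v, v)]).

Lemma step_add_loop V kind (G : graph V) v l x y :
  step (add_loop kind G v) l (x, y) <->
  step G l (x, y) \/ [/\ is_a l = kind, x = v & y = v].
Proof.
by case: l; case: kind => /=; split=> [[xy|[k [-> ->]]]|[xy|[k -> ->]]] //;
  first [by left|by right].
Qed.

Lemma step_del_loop V kind (G : graph V) v l x y :
  step (del_loop kind G v) l (x, y) <->
  step G l (x, y) /\ ~ [/\ is_a l = kind, x = v & y = v].
Proof.
by case: l; case: kind => /=; split=> -[xy nv]; split=> // h; apply: nv;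
  first [case: h => _ -> -> //|case: h => _ [-> ->] //|case: h => //].
Qed.

(** * Rooted reduced graphs sorted by the kinds of edges at the root *)

Section CountReduced.
Variables n k2 k3 l2 l3 : nat.
Hypothesis n1 : 1 < n.

Let L := rooted_reduced_graphs n k2 k3 l2 l3.

(** Not only loops are excluded: the root has no edge at all of this kind, in either direction for
    b. *)
Definition loop_free kind : set (graph 'I_n * 'I_n) :=
  [set p | forall l y, is_a l = kind -> ~ step p.1 l (p.2, y)].

Lemma loop_freeP kind G v : psl_graph G -> loop_free kind (G, v) ->
  forall l y, is_a l = kind -> ~ step G l (v, y) /\ ~ step G l (y, v).
Proof.
move=> GG fr l y lk; split; first exact: fr.
by move/(step_sym GG); apply: fr; rewrite is_a_linv.
Qed.

(** Adding the loop is a bijection onto pairs of a cyclically reduced graph and one of its loops of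
    this kind; each such graph has [l2 + 1] or [l3 + 1] of them. *)
Lemma card_loop_free kind :
  L `&` loop_free kind #= `I_(if kind then s_count n k2 k3 (l2 + 1) l3 * (l2 + 1)
                              else s_count n k2 k3 l2 (l3 + 1) * (l3 + 1)).
Proof.
pose S := cyclically_reduced_graphs n k2 k3 (if kind then l2 + 1 else l2)
  (if kind then l3 else l3 + 1).
pose F (G : graph 'I_n) := [set v | step G (if kind then la else lb) (v, v)].
pose add (p : graph 'I_n * 'I_n) := (add_loop kind p.1 p.2, p.2).
have addI : add @` (L `&` loop_free kind) = [set p | S p.1 /\ F p.1 p.2].
  apply/seteqP; split=> [_ [[G v] [[/= vG rG tG] fr] <-]|[G' v] [[/= vG' rG' tG'] lv]].
    have {}fr := loop_freeP (let: And3 GG _ _ := rG in GG) fr.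
    have st := @step_add_loop _ kind G v.
    split; last by apply/st; right; split=> //; case: (kind).
    split=> //; first exact/(reduced_add_loop vG _ fr st).
    exact/(type_add_loop vG _ fr st).
  have vv m : is_a m = kind -> step G' m (v, v)
    by move: lv; rewrite /F /=; case: (kind) m => [] [].
  pose G := del_loop kind G' v; have vG : verts G = setT by [].
  have st l x y : step G' l (x, y) <->
      step G l (x, y) \/ [/\ is_a l = kind, x = v & y = v].
    rewrite step_del_loop; split=> [xy|[[]|[lk -> ->]]] //; last exact: vv.
    by have [?|?] := pselect [/\ is_a l = kind, x = v & y = v]; [right|left].
  (* The loop at [v] in [G'] already uses up the unique outgoing and incoming step of each letter of
     this kind. *)
  have fr l y : is_a l = kind -> ~ step G l (v, y) /\ ~ step G l (y, v).
    by move=> lk; split=> /step_del_loop[xy]; apply; split=> //;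
      [apply: step_fun rG'.1 _ _ _ _ xy _
      |apply: step_inj rG'.1 _ _ _ _ xy _]; apply: vv.
  exists (G, v); last by rewrite /add /=; congr pair; apply: graph_ext => // l x y;
    rewrite step_add_loop -st.
  split; last by move=> l y /(fr _ y)[].
  split=> //; first exact/(reduced_add_loop vG vG' fr st).
  exact/(type_add_loop vG vG' fr st).
have add_inj : {in L `&` loop_free kind &, injective add}.
  (* An old edge of [G] cannot be the added loop, since the root of [G] has no edge of this kind. *)
  have half G G' v : loop_free kind (G, v) -> add_loop kind G v = add_loop kind G' v ->
      forall l x y, step G l (x, y) -> step G' l (x, y).
    move=> fr E l x y xy; have : step (add_loop kind G v) l (x, y).
      by apply/step_add_loop; left.
    rewrite E => /step_add_loop[//|[lk xv _]].
    by move: xy; rewrite xv => /fr; case.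
  move=> [G v] [G' v']; rewrite !inE => -[[/= vG _ _] fr] [[/= vG' _ _] fr'] eq_add.
  have vv : v = v' := congr1 snd eq_add; subst v'.
  have E : add_loop kind G v = add_loop kind G' v := congr1 fst eq_add.
  congr pair; apply: graph_ext => [|l x y]; first by rewrite vG vG'.
  by split; [apply: half fr E _ _ _|apply: half fr' (esym E) _ _ _].
rewrite -(card_eql (inj_card_eq add_inj)) addI.
have : [set p | S p.1 /\ F p.1 p.2] #=
    `I_(#|` fset_set S|%fset * if kind then l2 + 1 else l3 + 1).
  apply: card_sigma; first exact/card_fset_setE/finite_graphs.
  by move=> G [_ _ [_ _ _ la_ lb_]]; rewrite /F; case: (kind) la_ lb_.
by rewrite /S /s_count; case: (kind).
Qed.

(** Three disjoint classes: the root has both kinds of edges, and then the graph is cyclically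
    reduced with any of [n] roots, or it misses a, or it misses b. *)
Lemma L_count_split : L_count n k2 k3 l2 l3 =
  (n * s_count n k2 k3 l2 l3 + (l2 + 1) * s_count n k2 k3 (l2 + 1) l3
   + (l3 + 1) * s_count n k2 k3 l2 (l3 + 1))%N.
Proof.
pose S := cyclically_reduced_graphs n k2 k3 l2 l3.
have cardS : [set p | S p.1 /\ [set: 'I_n] p.2] #= `I_(s_count n k2 k3 l2 l3 * n).
  apply: (@card_sigma _ _ S (fun=> [set: 'I_n]));
    first exact/card_fset_setE/finite_graphs.
  by move=> G _; rewrite -[X in `I_X]card_ord; apply: card_setT_fin.
(* A root missing both kinds would have no first step towards another vertex. *)
have ab G v : rooted_reduced G v -> verts G = setT ->
    loop_free true (G, v) -> loop_free false (G, v) -> False.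
  move=> [GG _ _] vG fa fb.
  have [l [z]] := connected_edge v n1 (psl_connected GG) vG.
  by case: l => vz; [case: (fa la z)|case: (fb lb z)|case: (fb lB z)].
have disj1 : (L `&` loop_free true) `&` (L `&` loop_free false) = set0.
  apply/seteqP; split=> // -[G v] [[[/= vG rG _] fa] [_ fb]].
  exact: ab rG vG fa fb.
have disj0 : [set p | S p.1 /\ [set: 'I_n] p.2] `&`
    ((L `&` loop_free true) `|` (L `&` loop_free false)) = set0.
  apply/seteqP; split=> // -[G v] [[[/= vG [GG rG] _] _]].
  have [|[x vx] [y vy]] := rG v; rewrite ?vG // => -[[_ f]|[_ f]].
    exact: f la x erefl vx.
  by case: vy; [apply: f lb y erefl|apply: f lB y erefl].
have -> : L_count n k2 k3 l2 l3 = #|` fset_set L|%fset by [].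
have -> : L = [set p | S p.1 /\ [set: 'I_n] p.2] `|`
    ((L `&` loop_free true) `|` (L `&` loop_free false)).
  apply/seteqP; split=> [[G v] LGv|[G v]]; last first.
    move=> [[[/= vG [GG rG] tG] _]|[[]|[]]] //.
    by split=> //; split=> [//||x vx _]; rewrite ?vG //; apply: rG.
  have [fa|nfa] := pselect (loop_free true (G, v)); first by right; left.
  have [fb|nfb] := pselect (loop_free false (G, v)); first by right; right.
  left; case: LGv => /= vG [GG vv rG] tG; split=> //; split=> //; split=> // x vx.
  have [->|/eqP] := eqVneq x v; last exact: rG.
  split.
    apply: contrapT => no; apply: nfa => -[] // y _ vy.
    by apply: no; exists y.
  by apply: contrapT => no; apply: nfb => -[] // y _ vy; apply: no;
    exists y; [left|right].
have cA := card_loop_free true; have cB := card_loop_free false.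
rewrite (card_fset_set (card_setU_II cardS (card_setU_II cA cB disj1) disj0)).
by rewrite addnA [(_ * n)%N]mulnC [(_ * (l2 + 1))%N]mulnC [(_ * (l3 + 1))%N]mulnC.
Qed.

End CountReduced.

(** Finiteness is part of the conclusion because it makes [H_count] the true number of subgroups. *)
Theorem proposition4p2 (n k2 k3 l2 l3 : nat) (hn : (2 <= n)%N) :
  L_count n k2 k3 l2 l3 =
    (n * s_count n k2 k3 l2 l3
     + (l2 + 1) * s_count n k2 k3 (l2 + 1) l3
     + (l3 + 1) * s_count n k2 k3 l2 (l3 + 1))%N
  /\ finite_set (subgroups_of_type n k2 k3 l2 l3)
  /\ ((H_count n k2 k3 l2 l3)%:R = 1 / (n`!)%:R * (L_count n k2 k3 l2 l3)%:R
        :> rat)%R.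
Proof.
split; first exact: L_count_split.
split; first exact: finite_subgroups.
rewrite L_count_subgroups GRing.natrM GRing.mul1r [RHS]GRing.mulrC GRing.mulfK //.
by rewrite Num.Theory.pnatr_eq0 -lt0n fact_gt0.
Qed.
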